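(* Fix a constant $L>0$. There exist positive constants $C_1$ and $C_2$ (depending on $L$) such that the following holds. For all partitions $\lambda\vdash n$ and $\mu\vdash k$ such that $\lambda$ has fewer than $L\sqrt{n}$ rows and fewer than $L\sqrt{n}$ columns, $\mu$ has fewer than $L\sqrt{k}$ rows and fewer than $L\sqrt{k}$ columns, and $k<C_1n^{1/2}$, we have $$A_{\lambda/\mu}\le e^{C_2k^{3/2}n^{-1/2}}.$$
   Context: For a partition $\nu$, $f^\nu$ denotes the number of standard Young tableaux of shape $\nu$; for $\mu\subseteq\lambda$, $f^{\lambda/\mu}$ denotes the number of standard Young tableaux of skew shape $\lambda/\mu$. $A_{\lambda/\mu}:=|\mu|!\,\frac{f^{\lambda/\mu}}{f^\lambda f^\mu}$. *)

(* Defs.v *)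
From HB Require Import structures.
From mathcomp Require Import all_boot all_order all_algebra.
From mathcomp Require Import all_classical all_reals.
From mathcomp Require Import topology normedtype sequences exp.
Set Implicit Arguments. Unset Strict Implicit. Unset Printing Implicit Defensive.
Import Order.TTheory GRing.Theory Num.Theory.

(* Partitions are weakly decreasing sequences of positive integers
   (English convention: row i has length nth 0 la i). *)
Definition is_partition (la : seq nat) : bool :=
  sorted geq la && (0%N \notin la).

Definition partition_of (la : seq nat) (n : nat) : bool :=
  is_partition la && (sumn la == n).

Definition subpart (mu la : seq nat) : bool :=
  (size mu <= size la) && all (fun i => nth 0%N mu i <= nth 0%N la i) (iota 0 (size mu)).

Definition in_diag (la : seq nat) (i j : nat) : bool := j < nth 0%N la i.

Definition in_skew (la mu : seq nat) (i j : nat) : bool :=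
  in_diag la i j && ~~ in_diag mu i j.

(* A standard Young tableau of skew shape la/mu, with m = |la| - |mu| boxes,
   encoded as a function on the bounding box 'I_(#rows) x 'I_(#cols) of la,
   taking value 0 outside la/mu and giving a bijection of the cells of la/mu
   onto {1,...,m}, strictly increasing along rows and down columns. *)
Definition is_skewSYT (la mu : seq nat)
  (T : {ffun 'I_(size la) * 'I_(head 0%N la) -> 'I_((sumn la - sumn mu).+1)}) : bool :=
  let C := ('I_(size la) * 'I_(head 0%N la))%type in
  [forall c : C,
      if in_skew la mu c.1 c.2 then (0 < T c)%N else (T c == 0%N :> nat)]
  && [forall c : C, forall d : C,
      (in_skew la mu c.1 c.2 && in_skew la mu d.1 d.2 && (T c == T d)) ==> (c == d)]
  && [forall c : C, forall d : C,
      (in_skew la mu c.1 c.2 && in_skew la mu d.1 d.2 &&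
       (c.1 == d.1 :> nat) && (c.2 < d.2)%N) ==> (T c < T d)%N]
  && [forall c : C, forall d : C,
      (in_skew la mu c.1 c.2 && in_skew la mu d.1 d.2 &&
       (c.2 == d.2 :> nat) && (c.1 < d.1)%N) ==> (T c < T d)%N].

Arguments is_skewSYT : clear implicits.

Definition f_skew (la mu : seq nat) : nat :=
  if subpart mu la then #|[set T | is_skewSYT la mu T]| else 0%N.

Definition f_shape (nu : seq nat) : nat := f_skew nu [::].

Local Open Scope ring_scope.
Definition A_skew (R : realType) (la mu : seq nat) : R :=
  (sumn mu)`!%:R * (f_skew la mu)%:R / ((f_shape la)%:R * (f_shape mu)%:R).

(* Main.v *)
(** Proof idea.  Write s*_mu(la) for the shifted Schur function.  Its Pieri rule
    (|la| - k) s*_mu = sum of the s*_(mu + box), together with its vanishing when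
    mu is not contained in la, gives f^(la/mu) / f^la = (n - k)! s*_mu(la) / n!
    (Okounkov-Olshanski), without any hook formula.  The combinatorial formula for s*
    bounds s*_mu(la) by the ordinary Schur function s_mu(x) at x_i = la_i + #rows(mu),
    whose sum is n + O(sqrt (n k)) and whose entries are at most M = O(sqrt n).
    For x in [0, M]^N one has
      |mu| s_mu(x) <= sum over mu^- of (sum_i x_i + M * col(mu/mu^-)) s_(mu^-)(x),
    hence k! s_mu(x) <= (sum_i x_i + M * #cols(mu))^k f^mu, and
    A_(la/mu) <= ((n + O(sqrt (n k))) / (n - k))^k. *)
Require Import Defs.
From HB Require Import structures.
From mathcomp Require Import all_boot all_order all_algebra.
From mathcomp Require Import all_classical all_reals.
From mathcomp Require Import topology normedtype sequences exp.
From mathcomp Require Import zify ring lra.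
Import Order.TTheory GRing.Theory Num.Theory.
Set Implicit Arguments. Unset Strict Implicit. Unset Printing Implicit Defensive.
Local Open Scope ring_scope.

(** * Shapes and interlacing *)

(** The Pieri rule and the box-removal inequality share one proof pattern. Branching peels off one
    variable, the induction hypothesis acts on the inner shape, and after reindexing both sides are
    sums over rho of a coefficient times the Schur value of rho. It remains to compare coefficients
    for a single strip, including those rho that interlace with mu only after one box is added or
    removed. The value s*_la(la) is never computed: it cancels between the Pieri rule iterated from
    the empty shape and the same rule iterated from mu. In the final ratio, the excess #rows(la) *
    #rows(mu) of the sum of the x_i and the term M * #cols(mu) are both O(sqrt (n k)). So the base
    is 1 + O(sqrt (k / n)), and its k-th power produces the exponent k^(3/2) n^(-1/2). *)

(* A shape is its row-length function; [incr r] and [decr r] add and remove the last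
   box of row [r] (possibly leaving the set of partitions). *)
Definition incr (r : nat) (a : nat -> nat) (j : nat) : nat := (a j + (j == r))%N.
Definition decr (r : nat) (a : nat -> nat) (j : nat) : nat := (a j - (j == r))%N.

(** Sums need a finite index type while shapes are functions on [nat]; padding with empty rows links
    the two. *)
Definition ext (N K : nat) (nu : {ffun 'I_N -> 'I_K}) (j : nat) : nat :=
  oapp (fun i => nu i : nat) 0%N (insub j).

Lemma ext_ord N K (nu : {ffun 'I_N -> 'I_K}) (i : 'I_N) : ext nu i = nu i.
Proof. by rewrite /ext valK. Qed.

Lemma ext_out N K (nu : {ffun 'I_N -> 'I_K}) j : (N <= j)%N -> ext nu j = 0%N.
Proof. by move=> le_Nj; rewrite /ext insubN // -leqNgt. Qed.

Lemma incrK r a : decr r (incr r a) = a.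
Proof. by apply: funext => j; rewrite /decr /incr addnK. Qed.

Lemma ext_leq N K (nu : {ffun 'I_N -> 'I_K.+1}) j : (ext nu j <= K)%N.
Proof. by rewrite /ext; case: insub => //= i; rewrite -ltnS. Qed.

Lemma incr_neq r a j : j != r -> incr r a j = a j.
Proof. by rewrite /incr => /negPf->; rewrite addn0. Qed.

Lemma decr_neq r a j : j != r -> decr r a j = a j.
Proof. by rewrite /decr => /negPf->; rewrite subn0. Qed.

Lemma incr_eq r a : incr r a r = (a r).+1.
Proof. by rewrite /incr eqxx addn1. Qed.

Lemma decr_eq r a : decr r a r = (a r).-1.
Proof. by rewrite /decr eqxx subn1. Qed.

Lemma sum_incr (V : nmodType) N K (r : 'I_N) (G : (nat -> nat) -> V) :
  \sum_(nu : {ffun 'I_N -> 'I_K.+1} | (nu r < K)%N) G (incr r (ext nu)) =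
  \sum_(rho : {ffun 'I_N -> 'I_K.+1} | (0 < rho r)%N) G (ext rho).
Proof.
pose up (nu : {ffun 'I_N -> 'I_K.+1}) : {ffun 'I_N -> 'I_K.+1} :=
  [ffun i => inord (nu i + (i == r))%N].
pose dn (nu : {ffun 'I_N -> 'I_K.+1}) : {ffun 'I_N -> 'I_K.+1} :=
  [ffun i => inord (nu i - (i == r))%N].
have upE (nu : {ffun 'I_N -> 'I_K.+1}) (i : 'I_N) :
    (nu r < K)%N -> up nu i = (nu i + (i == r))%N :> nat.
  move=> lt_nuK; rewrite ffunE inordK //.
  by case: eqP => [->|_]; rewrite ?addn1 // addn0.
have dnE (nu : {ffun 'I_N -> 'I_K.+1}) (i : 'I_N) : dn nu i = (nu i - (i == r))%N :> nat.
  by rewrite ffunE inordK // (leq_ltn_trans (leq_subr _ _)).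
rewrite [RHS](reindex_onto up dn) => [|rho rho_gt0]; last first.
  have lt_dnK : (dn rho r < K)%N.
    rewrite dnE eqxx; move: rho_gt0 (ltn_ord (rho r)) => /=; lia.
  apply/ffunP => i; apply: val_inj; rewrite /= (upE _ _ lt_dnK) dnE.
  by case: eqP => [->|_]; rewrite ?subn0 ?addn0 // subnK.
apply: eq_big => [nu|nu lt_nuK].
  apply/idP/andP => [lt_nuK|[up_gt0 /eqP dn_up]].
    split; first by rewrite upE // eqxx addn1.
    by apply/eqP/ffunP => i; apply: val_inj; rewrite /= dnE upE // addnK.
  (* Whatever [inord] returns on overflow, [up nu r] is positive and [dn] lowers it back to [nu r],
     so [nu r = K] would force [up nu r = K + 1]. *)
  rewrite ltnNge; apply/negP => le_Knu.
  have := dnE (up nu) r; rewrite dn_up eqxx.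
  have := ltn_ord (up nu r); lia.
congr G; apply: funext => j; rewrite /incr.
have [lt_jN|le_Nj] := ltnP j N.
  by rewrite -[j]/(val (Ordinal lt_jN)) !ext_ord upE.
rewrite !ext_out //; case: eqP => // eq_jr; have := ltn_ord r; lia.
Qed.

Definition noninc (N : nat) (a : nat -> nat) : bool :=
  [forall i : 'I_N.-1, (a i.+1 <= a i)%N].

Lemma nonincP N a :
  reflect (forall i, (i.+1 < N)%N -> (a i.+1 <= a i)%N) (noninc N a).
Proof.
apply: (iffP forallP) => [H i lt_iN|H i].
  have lt_i : (i < N.-1)%N by lia.
  exact: (H (Ordinal lt_i)).
by apply: H; have := ltn_ord i; lia.
Qed.

Definition interlace (N : nat) (mu nu : nat -> nat) : bool :=
  [forall r : 'I_N, (nu r <= mu r)%N && (mu r.+1 <= nu r)%N].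

Lemma interlaceP N mu nu :
  reflect (forall r, (r < N)%N -> (nu r <= mu r)%N /\ (mu r.+1 <= nu r)%N)
    (interlace N mu nu).
Proof.
apply: (iffP forallP) => [H r lt_rN|H r].
  by apply/andP; exact: (H (Ordinal lt_rN)).
by apply/andP; apply: H.
Qed.

(** * Factorial Schur functions by branching *)

Section Schur.
Variable R : realDomainType.
Implicit Types (x M : R) (xs : seq R) (mu nu rho : nat -> nat).

Definition weight (phi : R -> nat -> nat -> R) N x mu nu : R :=
  \prod_(r < N.+1) \prod_(nu r <= c < mu r) phi x r c.

Definition strip phi N x mu nu : R := (interlace N mu nu)%:R * weight phi N x mu nu.

(* Branching rule: the first variable fills the horizontal strip mu/nu, and a box in
   row r and column c has weight [phi x r c].  As mu has at most [size xs] rows and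
   nu one row fewer, interlacing means that mu/nu is a horizontal strip.  It also forces
   mu to be non-increasing, so non-partitions get 0.  The bound [K] only makes the sum
   finite: the value is the expected one as soon as mu_r <= K for all r. *)
Fixpoint schur (phi : R -> nat -> nat -> R) K xs mu : R :=
  if xs is x :: xs' then
    \sum_(nu : {ffun 'I_(size xs') -> 'I_K.+1})
      strip phi (size xs') x mu (ext nu) * schur phi K xs' (ext nu)
  else 1.

(** This lets the sums over added or removed boxes range over all rows: an inadmissible row
    contributes 0. *)
Lemma schur_noninc0 phi K xs mu : ~~ noninc (size xs) mu -> schur phi K xs mu = 0.
Proof.
case: xs => [|x xs] /= muN; first by case/nonincP: muN.
rewrite big1 // => nu _; rewrite /strip.
case: interlaceP => [H|_]; last by rewrite !mul0r.
by case/nonincP: muN => i lt_i; have [] := H i lt_i; lia.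
Qed.

Lemma interlace_noninc N mu nu : interlace N mu nu -> noninc N nu.
Proof.
move/interlaceP => H; apply/nonincP => i lt_i.
by have [_ le1] := H i (ltnW lt_i); have [le2 _] := H _ lt_i; exact: leq_trans le1.
Qed.

End Schur.

Section Strips.
Variable R : realDomainType.
Implicit Types (x M : R) (xs : seq R) (mu nu rho : nat -> nat).

Lemma weight_incr (phi : R -> nat -> nat -> R) N x mu nu r : (r <= N)%N ->
  (nu r <= mu r)%N ->
  weight phi N x (incr r mu) nu = phi x r (mu r) * weight phi N x mu nu.
Proof.
move=> le_rN le_numu; pose r' := Ordinal (le_rN : (r < N.+1)%N).
rewrite /weight (bigD1 r') //= [in RHS](bigD1 r') //=.
rewrite incr_eq big_nat_recr //= mulrA (mulrC (phi _ _ _)); congr (_ * _).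
by apply: eq_bigr => i ne_ir; rewrite incr_neq.
Qed.

Lemma weight_decr (phi : R -> nat -> nat -> R) N x mu nu r : (r <= N)%N ->
  (0 < nu r)%N -> (nu r <= mu r)%N ->
  weight phi N x mu (decr r nu) = phi x r (nu r).-1 * weight phi N x mu nu.
Proof.
move=> le_rN nu_gt0 le_numu; pose r' := Ordinal (le_rN : (r < N.+1)%N).
rewrite /weight (bigD1 r') //= [in RHS](bigD1 r') //=.
rewrite decr_eq big_ltn ?prednK // mulrA; congr (_ * _).
by apply: eq_bigr => i ne_ir; rewrite decr_neq.
Qed.

(** Shortening nu and lengthening mu both leave row r without strip boxes. *)
Lemma weight_overhang (phi : R -> nat -> nat -> R) N x mu nu r :
  nu r = (mu r).+1 -> weight phi N x mu (decr r nu) = weight phi N x (incr r mu) nu.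
Proof.
move=> eq_numu; apply: eq_bigr => i _.
have [->|ne_ir] := eqVneq (i : nat) r; last by rewrite incr_neq ?decr_neq.
by rewrite decr_eq incr_eq eq_numu /= !big_geq.
Qed.

Lemma interlace_decr N mu rho r : interlace N mu rho -> (r < N)%N ->
  ((0 < rho r) && interlace N mu (decr r rho) = (mu r.+1 < rho r))%N.
Proof.
move=> /interlaceP H lt_rN; apply/andP/idP => [[rho_gt0 /interlaceP/(_ r lt_rN)]|lt].
  by rewrite decr_eq => -[_]; lia.
split; first lia.
apply/interlaceP => i lt_iN; have [h1 h2] := H i lt_iN.
by rewrite /decr; case: (eqVneq i r) h1 h2 => [->|_] h1 h2 /=; lia.
Qed.

Lemma interlace_incr0 N mu rho : interlace N mu rho -> interlace N (incr 0 mu) rho.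
Proof.
move=> /interlaceP H; apply/interlaceP => i lt_iN; have [h1 h2] := H i lt_iN.
by rewrite /incr; lia.
Qed.

(** The same strict inequality as in [interlace_decr], since both moves endanger only mu_(r+1) <=
    rho_r. This pairs row r with row r+1 in [strip_pieri]. *)
Lemma interlace_incrS N mu rho r : interlace N mu rho -> (r < N)%N ->
  interlace N (incr r.+1 mu) rho = (mu r.+1 < rho r)%N.
Proof.
move=> /interlaceP H lt_rN; apply/interlaceP/idP => [/(_ r lt_rN)|lt i lt_iN].
  by rewrite incr_eq => -[].
have [h1 h2] := H i lt_iN.
by rewrite /incr eqSS; case: (eqVneq i r) h1 h2 => [->|_] h1 h2 /=; lia.
Qed.

(** Either move relaxes only the bound rho_r <= mu_r, so that bound must be what fails, by one box.
    The remaining requirement is mu_(r+1) <= mu_r for shortening rho and rho_r <= rho_(r-1) for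
    lengthening mu; both are monotonicity. *)
Lemma interlace_overhang N mu rho r : noninc N.+1 mu -> noninc N rho ->
  ~~ interlace N mu rho -> (r < N)%N ->
  ((0 < rho r)%N && interlace N mu (decr r rho) = interlace N (incr r mu) rho) /\
  (interlace N (incr r mu) rho -> rho r = (mu r).+1).
Proof.
move=> /nonincP mu_ni /nonincP rho_ni nH lt_rN.
have inc_eq : interlace N (incr r mu) rho -> rho r = (mu r).+1.
  move/interlaceP => H; have [le_rho _] := H r lt_rN.
  apply/eqP; rewrite eqn_leq; rewrite incr_eq in le_rho; rewrite le_rho ltnNge.
  apply/negP => le; case/interlaceP: nH => i lt_iN; have [h1 h2] := H i lt_iN.
  have [eq_ir|ne_ir] := eqVneq i r.
    by split; [rewrite eq_ir | move: h2; rewrite /incr; lia].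
  by split; [rewrite incr_neq in h1 | move: h2; rewrite /incr; lia].
split=> //; apply/andP/idP => [[rho_gt0 /interlaceP H]|H]; last first.
  have eq_rho := inc_eq H; split; first by rewrite eq_rho.
  move/interlaceP in H; apply/interlaceP => i lt_iN; have [h1 h2] := H i lt_iN.
  have [eq_ir|ne_ir] := eqVneq i r.
    by rewrite eq_ir decr_eq eq_rho /=; split=> //; apply: mu_ni.
  by rewrite decr_neq //; move: h1 h2; rewrite /incr (negPf ne_ir) addn0; lia.
have eq_rho : rho r = (mu r).+1.
  have [+ _] := H r lt_rN; rewrite decr_eq => le_rho.
  apply/eqP; rewrite eqn_leq; apply/andP; split; first lia.
  rewrite ltnNge; apply/negP => le; case/interlaceP: nH => i lt_iN.
  have [h1 h2] := H i lt_iN.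
  by have [eq_ir|ne_ir] := eqVneq i r;
    [rewrite eq_ir decr_eq in h1 h2 *; lia | rewrite decr_neq in h1 h2].
apply/interlaceP => i lt_iN; have [h1 h2] := H i lt_iN.
have [eq_ir|ne_ir] := eqVneq i r.
  subst i; rewrite incr_eq /incr eq_rho; split=> //.
  by have := mu_ni r; rewrite ltnS lt_rN => /(_ isT); lia.
rewrite decr_neq // in h1 h2; rewrite incr_neq //; split=> //.
rewrite /incr; case: (eqVneq i.+1 r) => [eq_ir|_]; last by rewrite addn0.
by have := rho_ni i; rewrite eq_ir eq_rho lt_rN => /(_ isT); lia.
Qed.

(* With these weights, [schur] is the shifted Schur function: c - r is the content. *)
Definition shift x (r c : nat) : R := x - c%:R + r%:R.

(* The two sums match term by term, row r on the left with row r.+1 on the right when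
   mu/rho is a strip; otherwise rho overhangs mu by one box and the rows agree. *)
Lemma strip_pieri N x mu rho : noninc N.+1 mu -> noninc N rho -> rho N = 0%N ->
  (x - \sum_(r < N.+1) (mu r)%:R + \sum_(r < N) (rho r)%:R) * strip shift N x mu rho
    + \sum_(r < N) (0 < rho r)%N%:R * strip shift N x mu (decr r rho) =
  \sum_(r < N.+1) strip shift N x (incr r mu) rho.
Proof.
move=> mu_ni rho_ni rhoN0; have [H|nH] := boolP (interlace N mu rho); last first.
  rewrite {1}/strip (negPf nH) mul0r mulr0 add0r big_ord_recr /=.
  (* Lengthening row N only tightens a lower bound on rho, so it cannot repair interlacing. *)
  rewrite [X in _ = _ + X](_ : _ = 0) ?addr0; last first.
    rewrite /strip; case: interlaceP => [H|_]; last by rewrite mul0r.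
    case/interlaceP: nH => i lt_iN; have [h1 h2] := H i lt_iN.
    move: h1; rewrite incr_neq ?ltn_eqF //; move: h2; rewrite /incr; lia.
  apply: eq_bigr => r _; rewrite /strip mulrA -natrM mulnb.
  have [-> Hr] := interlace_overhang mu_ni rho_ni nH (ltn_ord r).
  by case: (interlace N (incr r mu) rho) Hr => [/(_ isT)/weight_overhang->|]; rewrite ?mul0r.
have le_rho r : (r <= N)%N -> (rho r <= mu r)%N.
  rewrite leq_eqVlt => /orP[/eqP->|lt_rN]; first by rewrite rhoN0.
  by have [] := interlaceP _ _ _ H r lt_rN.
set W := weight shift N x mu rho.
have stripE : strip shift N x mu rho = W by rewrite /strip H mul1r.
have lhsE (r : 'I_N) : (0 < rho r)%N%:R * strip shift N x mu (decr r rho) =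
    (mu r.+1 < rho r)%N%:R * shift x r (rho r).-1 * W.
  rewrite /strip mulrA -natrM mulnb (interlace_decr H (ltn_ord r)) -mulrA.
  have [lt|_] := ltnP (mu r.+1) (rho r); last by rewrite !mul0r.
  by rewrite weight_decr ?le_rho ?(leq_ltn_trans _ lt) // (ltnW (ltn_ord r)).
have rhsE (r : 'I_N) : strip shift N x (incr r.+1 mu) rho =
    (mu r.+1 < rho r)%N%:R * shift x r.+1 (mu r.+1) * W.
  by rewrite /strip (interlace_incrS H (ltn_ord r)) weight_incr ?le_rho // -?mulrA.
rewrite stripE (eq_bigr _ (fun r _ => lhsE r)) -mulr_suml -mulrDl.
rewrite [RHS]big_ord_recl /= {1}/strip (interlace_incr0 H) mul1r weight_incr ?le_rho //.
rewrite (eq_bigr _ (fun r _ => rhsE r)) -mulr_suml -mulrDl; congr (_ * _).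
rewrite big_ord_recl /= [in RHS]/shift addr0 opprD addrA -!addrA; congr (_ + (_ + _)).
(* The box added to row r+1 of mu and the box removed from row r of rho have weights differing by
   exactly rho_r - mu_(r+1); without a strict gap this difference is 0. *)
rewrite -sumrN -!big_split /=; apply: eq_bigr => r _.
have [_ le_mu] := interlaceP _ _ _ H r (ltn_ord r); rewrite /bump /= add1n.
have [lt|le] := ltnP (mu r.+1) (rho r); rewrite ?mul0r ?mul1r /shift.
  case: (rho r) lt => // p _; rewrite /= -(natr1 p) -(natr1 r); ring.
have -> : mu r.+1 = rho r by lia.
ring.
Qed.
End Strips.
Arguments shift {R} x r c.

(** * Pieri rule and the box-removal inequality *)

Section Expansions.
Variable R : realDomainType.
Implicit Types (x M : R) (xs : seq R) (mu nu rho : nat -> nat).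

Lemma sum_strip_incr (phi : R -> nat -> nat -> R) N K x mu (r : 'I_N) (g : (nat -> nat) -> R) :
  (mu r < K)%N ->
  \sum_(nu : {ffun 'I_N -> 'I_K.+1}) strip phi N x mu (ext nu) * g (incr r (ext nu)) =
  \sum_(rho : {ffun 'I_N -> 'I_K.+1})
     (0 < ext rho r)%N%:R * strip phi N x mu (decr r (ext rho)) * g (ext rho).
Proof.
move=> lt_muK; rewrite (bigID (fun nu : {ffun 'I_N -> 'I_K.+1} => nu r < K)%N) /=.
rewrite [X in _ + X]big1 ?addr0 => [|nu]; last first.
  rewrite -leqNgt /strip => le_Knu.
  case: interlaceP => [/(_ r (ltn_ord r))|]; last by rewrite !mul0r.
  by rewrite ext_ord; lia.
have /= := @sum_incr R N K r (fun a => strip phi N x mu (decr r a) * g a).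
under eq_bigr => nu _ do rewrite incrK.
move=> ->; rewrite big_mkcond; apply: eq_bigr => rho _; rewrite ext_ord.
by case: (0 < rho r)%N; rewrite ?mul1r ?mul0r.
Qed.

Theorem schur_pieri K xs mu : noninc (size xs) mu ->
  (forall r, (r < size xs)%N -> (mu r < K)%N) ->
  (\sum_(x <- xs) x - \sum_(r < size xs) (mu r)%:R) * schur shift K xs mu =
  \sum_(r < size xs) schur shift K xs (incr r mu).
Proof.
elim: xs mu => [|x xs IH] mu mu_ni lt_muK; first by rewrite big_nil !big_ord0 subr0 mul0r.
set N := size xs; set S := schur shift K xs.
(* The factor splits as (x - |mu| + |nu|) plus (sum of xs - |nu|), and the second part is the factor
   in the induction hypothesis for nu. *)
transitivity (\sum_(nu : {ffun 'I_N -> 'I_K.+1})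
   ((x - \sum_(r < N.+1) (mu r)%:R + \sum_(r < N) (ext nu r)%:R)
        * strip shift N x mu (ext nu) * S (ext nu) +
     \sum_(r < N) strip shift N x mu (ext nu) * S (incr r (ext nu)))).
  rewrite big_cons /= mulr_sumr; apply: eq_bigr => nu _; rewrite -mulr_sumr.
  rewrite /strip; have [H|] := boolP (interlace N mu (ext nu)); last by rewrite !(mul0r, mulr0) addr0.
  rewrite -IH; first by rewrite -/N -/S; ring.
    exact: interlace_noninc H.
  move=> r lt_rN; have [le_nu _] := interlaceP _ _ _ H r lt_rN.
  by apply: leq_ltn_trans le_nu _; apply: lt_muK; rewrite ltnS ltnW.
rewrite big_split exchange_big /=.
under [X in _ + X]eq_bigr => r _ do
  rewrite (sum_strip_incr shift x S (lt_muK _ (ltnW (ltn_ord r : (r.+1 < N.+1)%N)))).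
rewrite exchange_big -big_split [RHS]exchange_big /=; apply: eq_bigr => rho _.
rewrite -!mulr_suml -mulrDl.
have [rho_ni|/schur_noninc0 S0] := boolP (noninc N (ext rho)); last by rewrite /S S0 !mulr0.
by rewrite strip_pieri // ext_out.
Qed.

(** A box weight independent of the position gives the ordinary Schur polynomial. *)
Definition plain x (r c : nat) : R := x.

Lemma weight_plainE N x mu nu : weight plain N x mu nu = x ^+ (\sum_(r < N.+1) (mu r - nu r)).
Proof.
by rewrite /weight -prodrXr; apply: eq_bigr => r _; rewrite prodr_const_nat.
Qed.

Lemma strip_plain_ge0 N x mu nu : 0 <= x -> 0 <= strip plain N x mu nu.
Proof. by move=> x_ge0; rewrite /strip weight_plainE mulr_ge0 ?exprn_ge0. Qed.

Lemma schur_plain_ge0 K xs mu : (forall x, x \in xs -> 0 <= x) -> 0 <= schur plain K xs mu.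
Proof.
elim: xs mu => [|x xs IH] mu xs_ge0 //=; apply: sumr_ge0 => nu _.
apply: mulr_ge0; first by rewrite strip_plain_ge0 ?xs_ge0 ?mem_head.
by apply: IH => y xs_y; rewrite xs_ge0 // in_cons xs_y orbT.
Qed.

Lemma sum_pred1 N (e : nat -> nat) r : (r <= N)%N -> (0 < e r)%N ->
  (\sum_(j < N.+1) (e j - (j == r :> nat)))%N = (\sum_(j < N.+1) e j).-1.
Proof.
move=> le_rN e_gt0; pose r' := Ordinal (le_rN : (r < N.+1)%N).
rewrite (bigD1 r') //= [in RHS](bigD1 r') //= eqxx.
under eq_bigr => j ne_jr do rewrite (negPf (ne_jr : (j : nat) != r)) subn0.
lia.
Qed.

Lemma weight_plain_incr N x mu nu r : (r <= N)%N -> (nu r < mu r)%N ->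
  weight plain N x mu (incr r nu) = x ^+ (\sum_(r < N.+1) (mu r - nu r)).-1.
Proof.
move=> le_rN lt; rewrite weight_plainE -(@sum_pred1 _ (fun j => mu j - nu j)%N _ le_rN) ?subn_gt0 //.
by congr (_ ^+ _); apply: eq_bigr => j _; rewrite /incr subnDA.
Qed.

Lemma weight_plain_decr N x mu nu r : (r <= N)%N -> (nu r < mu r)%N ->
  weight plain N x (decr r mu) nu = x ^+ (\sum_(r < N.+1) (mu r - nu r)).-1.
Proof.
move=> le_rN lt; rewrite weight_plainE -(@sum_pred1 _ (fun j => mu j - nu j)%N _ le_rN) ?subn_gt0 //.
by congr (_ ^+ _); apply: eq_bigr => j _; rewrite /decr subnAC.
Qed.

Lemma interlace_incr_inner N mu rho r : interlace N mu rho -> (r < N)%N ->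
  interlace N mu (incr r rho) = (rho r < mu r)%N.
Proof.
move=> /interlaceP H lt_rN; apply/interlaceP/idP => [/(_ r lt_rN)|lt i lt_iN].
  by rewrite incr_eq => -[].
by have [h1 h2] := H i lt_iN; rewrite /incr; case: (eqVneq i r) h1 h2 => [->|_] h1 h2 /=; lia.
Qed.

Lemma interlace_decr_outer N mu rho r : interlace N mu rho -> (rho r < mu r)%N ->
  interlace N (decr r mu) rho.
Proof.
move=> /interlaceP H lt; apply/interlaceP => i lt_iN; have [h1 h2] := H i lt_iN.
by rewrite /decr; case: (eqVneq i r) h1 h2 => [->|_] h1 h2 /=; lia.
Qed.

(** The only bound that lengthening row r of rho can repair is mu_(r+1) <= rho_r, which must fail by
    one box; shortening row r+1 of mu repairs it as well. *)
Lemma interlace_jump N mu rho r : noninc N rho -> ~~ interlace N mu rho -> (r < N)%N ->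
  interlace N mu (incr r rho) ->
  mu r.+1 = (rho r).+1 /\ interlace N (decr r.+1 mu) rho.
Proof.
move=> /nonincP rho_ni nH lt_rN /interlaceP H.
have [h1 h2] := H r lt_rN; rewrite incr_eq in h1 h2.
have eq_mu : mu r.+1 = (rho r).+1.
  apply/eqP; rewrite eqn_leq h2 ltnNge; apply/negP => le; case/interlaceP: nH => i lt_iN.
  have [g1 g2] := H i lt_iN.
  have [eq_ir|ne_ir] := eqVneq i r; last by rewrite incr_neq in g1 g2.
  by rewrite eq_ir; lia.
split=> //; apply/interlaceP => i lt_iN; have [g1 g2] := H i lt_iN.
rewrite /decr eqSS; have [eq_ir|ne_ir] := eqVneq i r.
  by subst i; rewrite eq_mu; lia.
rewrite incr_neq // in g1 g2; case: eqVneq => [eq_ir|_]; last by lia.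
by subst i; have := rho_ni r lt_iN; rewrite eq_mu /= in g1 g2 *; lia.
Qed.

End Expansions.
Arguments plain {R} x r c.

(** * The box-removal inequality for ordinary Schur polynomials *)

Section Bounds.
Variable R : realDomainType.
Implicit Types (x M : R) (xs : seq R) (mu nu rho : nat -> nat).

(* Coefficientwise form of [schur_euler].  In a row with e > 0 strip boxes, adding the
   leftmost box to rho costs column rho_r while removing the rightmost box from mu gains
   column rho_r + e - 1, which pays for the e - 1 excess factors x <= M. *)
Lemma strip_euler N x M (X : R) mu rho :
  0 <= x -> x <= M -> 0 <= X -> noninc N rho -> rho N = 0%N ->
  (\sum_(r < N.+1) (mu r)%:R - \sum_(r < N) (rho r)%:R) * strip plain N x mu rho
    + \sum_(r < N) strip plain N x mu (incr r rho) * (X + M * (rho r)%:R) <=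
  \sum_(r < N.+1) (0 < mu r)%N%:R * (X + x + M * (mu r).-1%:R)
                    * strip plain N x (decr r mu) rho.
Proof.
move=> x_ge0 le_xM X_ge0 rho_ni rhoN0.
have M_ge0 : 0 <= M := le_trans x_ge0 le_xM.
set V := x ^+ (\sum_(r < N.+1) (mu r - rho r)).-1.
have V_ge0 : 0 <= V by rewrite exprn_ge0.
have rhs_ge0 r : 0 <= (0 < mu r)%N%:R * (X + x + M * (mu r).-1%:R)
                    * strip plain N x (decr r mu) rho.
  apply: mulr_ge0; last exact: strip_plain_ge0.
  by rewrite mulr_ge0 // addr_ge0 ?mulr_ge0 // addr_ge0.
have [H|nH] := boolP (interlace N mu rho); last first.
  rewrite {1}/strip (negPf nH) mul0r mulr0 add0r big_ord_recl /=.
  (* Outside the strip case, row r on the left is compared with row r+1 on the right, where mu_(r+1)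
     - 1 = rho_r; the right factor is larger by x. *)
  apply: ler_wpDl => //; apply: ler_sum => r _; rewrite /bump /= add1n.
  have [Hr|] := boolP (interlace N mu (incr r rho)); last first.
    by rewrite /strip => /negPf->; rewrite !mul0r; apply: rhs_ge0.
  have [eq_mu Hd] := interlace_jump rho_ni nH (ltn_ord r) Hr.
  have lt_r : (rho r < mu r)%N.
    by have [] := interlaceP _ _ _ Hr r (ltn_ord r); rewrite incr_eq.
  have lt_rS : (rho r.+1 < mu r.+1)%N.
    rewrite eq_mu ltnS; have [lt_rN|] := ltnP r.+1 N.
      by have /nonincP := rho_ni; apply.
    by move=> le_Nr; have -> : r.+1 = N by [have := ltn_ord r; lia]; rewrite rhoN0.
  rewrite /strip Hr Hd weight_plain_incr ?weight_plain_decr ?(ltnW (ltn_ord r)) //.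
  rewrite eq_mu /= !mul1r -/V mulrC ler_wpM2r // -addrA lerD2l lerDr.
  exact: x_ge0.
(* In the strip case the comparison is row by row, with the degree |mu| - |rho| distributed as the
   number of strip boxes in each row. *)
have term r : (r <= N)%N ->
    (mu r - rho r)%N%:R * strip plain N x mu rho
      + (r < N)%N%:R * (strip plain N x mu (incr r rho) * (X + M * (rho r)%:R)) <=
    (0 < mu r)%N%:R * (X + x + M * (mu r).-1%:R) * strip plain N x (decr r mu) rho.
  move=> le_rN; have [lt_r|ge_r] := ltnP (rho r) (mu r); last first.
    have -> : (mu r - rho r = 0)%N by apply/eqP.
    rewrite mul0r add0r; case: ltnP => [lt_rN|_]; last by rewrite mul0r; apply: rhs_ge0.
    by rewrite /strip interlace_incr_inner // ltnNge ge_r !(mul0r, mulr0); apply: rhs_ge0.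
  have wE : weight plain N x mu rho = x * V.
    rewrite weight_plainE -exprS prednK // (bigD1 (Ordinal (le_rN : (r < N.+1)%N))) //=.
    by rewrite addn_gt0 subn_gt0 lt_r.
  rewrite {1}/strip H wE {2}/strip (interlace_decr_outer H lt_r) weight_plain_decr // -/V.
  rewrite (leq_trans _ lt_r) //= !mul1r.
  have -> : (r < N)%N%:R * (strip plain N x mu (incr r rho) * (X + M * (rho r)%:R)) =
            (r < N)%N%:R * (V * (X + M * (rho r)%:R)).
    case: (ltnP r N) => [lt_rN|_]; last by rewrite !mul0r.
    by rewrite /strip interlace_incr_inner // lt_r weight_plain_incr // !mul1r.
  apply: (@le_trans _ _ ((mu r - rho r)%N%:R * (x * V) + V * (X + M * (rho r)%:R))).
    rewrite lerD2l; case: (ltnP r N) => [lt_rN|_]; rewrite ?mul1r // mul0r.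
    by rewrite mulr_ge0 // addr_ge0 // mulr_ge0.
  have [d ->] : exists d, mu r = (rho r + d).+1 by exists (mu r - rho r).-1; lia.
  rewrite -addnS addKn addnS /= natrD -natr1.
  rewrite mulrA [V * _]mulrC -mulrDl ler_wpM2r //.
  rewrite -subr_ge0 (_ : _ - _ = d%:R * (M - x)); last by ring.
  by rewrite mulr_ge0 // subr_ge0.
have -> : \sum_(r < N.+1) (mu r)%:R - \sum_(r < N) (rho r)%:R =
          \sum_(r < N.+1) (mu r - rho r)%N%:R :> R.
  rewrite !big_ord_recr /= rhoN0 subn0 addrAC; congr (_ + _).
  rewrite -sumrB; apply: eq_bigr => r _; rewrite natrB //.
  by have [] := interlaceP _ _ _ H r (ltn_ord r).
rewrite mulr_suml.
have -> : \sum_(r < N) strip plain N x mu (incr r rho) * (X + M * (rho r)%:R) =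
  \sum_(r < N.+1) (r < N)%N%:R * (strip plain N x mu (incr r rho) * (X + M * (rho r)%:R)).
  rewrite big_ord_recr /= ltnn mul0r addr0; apply: eq_bigr => r _.
  by rewrite ltn_ord mul1r.
by rewrite -big_split; apply: ler_sum => r _; apply: term; rewrite -ltnS.
Qed.

(** Counterpart of [sum_strip_incr] for removal; [h] carries the factor depending on the column of
    the removed box. *)
Lemma sum_strip_decr (phi : R -> nat -> nat -> R) N K x mu (r : 'I_N)
    (h : nat -> R) (g : (nat -> nat) -> R) :
  (mu r <= K)%N ->
  \sum_(nu : {ffun 'I_N -> 'I_K.+1})
     strip phi N x mu (ext nu) * h (ext nu r) * ((0 < ext nu r)%N%:R * g (decr r (ext nu))) =
  \sum_(rho : {ffun 'I_N -> 'I_K.+1})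
     strip phi N x mu (incr r (ext rho)) * h (ext rho r).+1 * g (ext rho).
Proof.
move=> le_muK; rewrite [RHS](bigID (fun nu : {ffun 'I_N -> 'I_K.+1} => nu r < K)%N) /=.
rewrite [X in _ = _ + X]big1 ?addr0 => [|nu]; last first.
  rewrite -leqNgt /strip => le_Knu.
  case: interlaceP => [/(_ r (ltn_ord r))|]; last by rewrite !mul0r.
  by rewrite incr_eq ext_ord; lia.
have /= := @sum_incr R N K r (fun a => strip phi N x mu a * h (a r) * g (decr r a)).
under eq_bigr => nu _ do rewrite incrK incr_eq.
move=> ->; rewrite [RHS]big_mkcond; apply: eq_bigr => rho _; rewrite ext_ord.
by case: (0 < rho r)%N; rewrite ?mul1r // mul0r mulr0.
Qed.

(** For one variable and a row of m > 0 boxes this reads m x^m <= (x + M (m - 1)) x^(m-1), an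
    equality at x = M, which accounts for the column term. *)
Theorem schur_euler K M xs mu : (forall x, x \in xs -> 0 <= x <= M) ->
  (forall r, (r < size xs)%N -> (mu r <= K)%N) ->
  (\sum_(r < size xs) (mu r)%:R) * schur plain K xs mu <=
  \sum_(r < size xs) (0 < mu r)%N%:R * (\sum_(x <- xs) x + M * (mu r).-1%:R)
                       * schur plain K xs (decr r mu).
Proof.
elim: xs mu => [|x xs IH] mu xs_M le_muK; first by rewrite !big_ord0 mul0r.
set N := size xs; set S := schur plain K xs; set X := \sum_(x <- xs) x.
have xs_M' y : y \in xs -> 0 <= y <= M by move=> xs_y; apply: xs_M; rewrite in_cons xs_y orbT.
have S_ge0 nu : 0 <= S nu by apply: schur_plain_ge0 => y /xs_M' /andP[].
have /andP[x_ge0 le_xM] := xs_M x (mem_head _ _).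
have X_ge0 : 0 <= X by rewrite /X big_seq; apply: sumr_ge0 => y /xs_M' /andP[].
(* The degree splits as |mu| = (|mu| - |nu|) + |nu|, and the induction hypothesis bounds the part
   |nu|. *)
apply: (@le_trans _ _ (\sum_(nu : {ffun 'I_N -> 'I_K.+1})
   ((\sum_(r < N.+1) (mu r)%:R - \sum_(r < N) (ext nu r)%:R)
        * strip plain N x mu (ext nu) * S (ext nu) +
     \sum_(r < N) (strip plain N x mu (ext nu) * (X + M * (ext nu r).-1%:R)) *
                    ((0 < ext nu r)%N%:R * S (decr r (ext nu)))))).
  rewrite /= mulr_sumr; apply: ler_sum => nu _.
  have IHnu := IH (ext nu) xs_M' (fun r _ => ext_leq nu r).
  have {IHnu} := ler_wpM2l (strip_plain_ge0 N mu (ext nu) x_ge0) IHnu.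
  rewrite -/N -/S -/X mulr_sumr.
  set w := strip _ _ _ _ _; set A := \sum_(r < N.+1) _; set B := \sum_(r < N) _ => IHnu.
  rewrite (_ : A * _ = (A - B) * w * S (ext nu) + w * (B * S (ext nu))); last by ring.
  rewrite lerD2l (le_trans IHnu) //; apply: ler_sum => r _.
  by rewrite le_eqVlt; apply/orP; left; apply/eqP; ring.
have -> : \sum_(r < N.+1) (0 < mu r)%N%:R * (\sum_(y <- x :: xs) y + M * (mu r).-1%:R)
                       * schur plain K (x :: xs) (decr r mu) =
   \sum_(nu : {ffun 'I_N -> 'I_K.+1}) (\sum_(r < N.+1) (0 < mu r)%N%:R * (X + x + M * (mu r).-1%:R)
                    * strip plain N x (decr r mu) (ext nu)) * S (ext nu).
  under [RHS]eq_bigr => nu _ do rewrite mulr_suml.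
  rewrite exchange_big; apply: eq_bigr => r _ /=; rewrite mulr_sumr big_cons [x + _]addrC.
  by apply: eq_bigr => nu _; rewrite !mulrA.
rewrite big_split exchange_big /=.
under [X in _ + X]eq_bigr => r _ do
  rewrite (sum_strip_decr plain x (fun n => X + M * n.-1%:R) S (le_muK _ (ltnW (ltn_ord r : (r.+1 < N.+1)%N)))) /=.
rewrite exchange_big -big_split /=; apply: ler_sum => nu _.
rewrite -mulr_suml -mulrDl.
have [nu_ni|/schur_noninc0 S0] := boolP (noninc N (ext nu)); last by rewrite /S S0 !mulr0.
by rewrite ler_wpM2r // strip_euler // ext_out.
Qed.
End Bounds.

(** * Vanishing and comparison *)

Section Vanishing.
Variable R : realDomainType.
Implicit Types (x M : R) (xs : seq R) (mu nu rho : nat -> nat).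

Lemma eq_schur (phi : R -> nat -> nat -> R) K xs mu mu' :
  (forall r, (r < size xs)%N -> mu r = mu' r) ->
  schur phi K xs mu = schur phi K xs mu'.
Proof.
case: xs => [|x xs] //= eq_mu; apply: eq_bigr => nu _; congr (_ * _).
have int_eq : interlace (size xs) mu (ext nu) = interlace (size xs) mu' (ext nu).
  by apply: eq_forallb => r; have lt_r : (r < size xs)%N := ltn_ord r; rewrite !eq_mu // ltnS ltnW.
rewrite /strip int_eq; congr (_ * _).
by apply: eq_bigr => r _; rewrite eq_mu.
Qed.

Lemma schur0 (phi : R -> nat -> nat -> R) K xs mu :
  (forall r, (r < size xs)%N -> mu r = 0%N) -> schur phi K xs mu = 1.
Proof.
move=> mu0; rewrite (@eq_schur _ _ _ _ (fun=> 0%N)) // => {mu mu0}.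
elim: xs => [|x xs IH] //=; pose z : {ffun 'I_(size xs) -> 'I_K.+1} := [ffun=> ord0].
have ext_z : ext z = (fun=> 0%N).
  by apply: funext => j; rewrite /ext; case: insub => //= i; rewrite ffunE.
rewrite (bigD1 z) //= ext_z.
rewrite IH mulr1 /strip /weight big1 => [|r _]; last by rewrite big_geq.
rewrite (_ : interlace _ _ _) ?mul1r; last by apply/interlaceP.
rewrite big1 ?addr0 // => nu nu_neq0; rewrite (_ : interlace _ _ _ = false) ?mul0r //.
apply: contraNF nu_neq0 => /interlaceP H; apply/eqP/ffunP => i; apply: val_inj.
by have [+ _] := H i (ltn_ord i); rewrite ext_ord ffunE /= leqn0 => /eqP.
Qed.

Lemma sorted_geq_head l (la : seq nat) r :
  sorted geq (l :: la) -> (nth 0 (l :: la) r <= l)%N.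
Proof.
move=> /= la_s; have /allP le_l : all (geq l) la.
  by apply: order_path_min la_s => a b c /= h1 h2; apply: leq_trans h1.
case: r => [|r] //=; have [lt|le] := ltnP r (size la); last by rewrite nth_default.
exact/le_l/mem_nth.
Qed.

(* A box in row 0 and column l has weight l - l = 0. *)
Lemma schur_shift_vanish K (la : seq nat) mu r : sorted geq la -> (r < size la)%N ->
  (nth 0 la r < mu r)%N -> schur shift K [seq l%:R : R | l <- la] mu = 0.
Proof.
elim: la mu r => [|l la IH] mu r //= la_s lt_r lt_mu; rewrite size_map; set N := size la.
rewrite big1 // => nu _; rewrite /strip.
case: interlaceP => [H|_]; last by rewrite !mul0r.
have la_s' : sorted geq la := path_sorted la_s.
have [/existsP[i lt_i]|/existsPn le_nu] := boolP [exists i : 'I_N, (nth 0 la i < ext nu i)%N].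
  by rewrite (IH _ i) ?mulr0.
have {}le_nu i : (i < N)%N -> (ext nu i <= nth 0 la i)%N.
  by move=> lt_i; rewrite leqNgt; exact: (le_nu (Ordinal lt_i)).
(* By interlacing, mu_(r+1) <= nu_r is at most the corresponding row of la, so the excess sits in
   row 0. There nu_0 <= l too, so the strip contains the box in column l. *)
case: r lt_r lt_mu => [_ /= lt_mu|r lt_r /= lt_mu]; last first.
  by have [_] := H r lt_r; have := le_nu r lt_r; lia.
have le_nu0 : (ext nu 0 <= l)%N.
  have [N_gt0|] := ltnP 0 N; last by move=> le_N0; rewrite ext_out.
  exact: leq_trans (le_nu 0%N N_gt0) (sorted_geq_head 1 la_s).
rewrite mul1r /weight (bigD1 ord0) //= (big_cat_nat _ (n := l)) ?(ltnW lt_mu) //=.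
by rewrite [X in _ * X * _ * _]big_ltn // /shift subrr addr0 mul0r mulr0 !mul0r.
Qed.

(** Terms with nu outside la vanish. In the others each strip box has c < mu_r <= la_r <= l and r <
    h, so its weight l - c + r lies between 0 and l + h. *)
Lemma schur_shift_le K h (la : seq nat) mu : sorted geq la ->
  (forall r, (r < size la)%N -> (mu r <= nth 0 la r)%N) ->
  (forall r, (r < size la)%N -> (h <= r)%N -> mu r = 0%N) ->
  0 <= schur shift K [seq l%:R : R | l <- la] mu <=
       schur plain K [seq (l + h)%:R : R | l <- la] mu.
Proof.
elim: la mu => [|l la IH] mu la_s le_mu mu_h; first by rewrite /= ler01 lexx.
have la_s' : sorted geq la := path_sorted la_s.
rewrite /= !size_map; set N := size la.
have S_ge0 nu : 0 <= schur plain K [seq (l + h)%:R : R | l <- la] nu.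
  by apply: schur_plain_ge0 => x /mapP[y _ ->].
suff H (nu : {ffun 'I_N -> 'I_K.+1}) :
    0 <= strip shift N l%:R mu (ext nu) * schur shift K [seq l%:R : R | l <- la] (ext nu) <=
    strip plain N (l + h)%:R mu (ext nu) *
      schur plain K [seq (l + h)%:R : R | l <- la] (ext nu).
  apply/andP; split; first by apply: sumr_ge0 => nu _; case/andP: (H nu).
  by apply: ler_sum => nu _; case/andP: (H nu).
have [/existsP[i lt_i]|/existsPn le_nu] := boolP [exists i : 'I_N, (nth 0 la i < ext nu i)%N].
  by rewrite (schur_shift_vanish _ la_s' (ltn_ord i)) // mulr0 lexx mulr_ge0 ?strip_plain_ge0.
have {}le_nu i : (i < N)%N -> (ext nu i <= nth 0 la i)%N.
  by move=> lt_i; rewrite leqNgt; exact: (le_nu (Ordinal lt_i)).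
rewrite /strip; case: interlaceP => [H|_]; last by rewrite !mul0r lexx.
have /andP[IH1 IH2] : 0 <= schur shift K [seq l%:R : R | l <- la] (ext nu) <=
    schur plain K [seq (l + h)%:R : R | l <- la] (ext nu).
  apply: IH => // r lt_r le_hr; have [+ _] := H r lt_r.
  by rewrite mu_h ?leqn0 => [/eqP| |] //; rewrite /= ltnS ltnW.
have box (r : 'I_N.+1) c : (c < mu r)%N -> 0 <= shift (l%:R : R) r c <= plain ((l + h)%:R : R) r c.
  move=> lt_c; have le_cl : (c < l)%N.
    by apply: leq_trans lt_c (leq_trans (le_mu r (ltn_ord r)) (sorted_geq_head r la_s)).
  have lt_rh : (r < h)%N.
    by rewrite ltnNge; apply/negP => /(mu_h r (ltn_ord r)) mu0; rewrite mu0 in lt_c.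
  rewrite /shift /plain -natrB 1?ltnW // -natrD ler0n ler_nat; lia.
have wt : 0 <= weight shift N (l%:R : R) mu (ext nu) <= weight plain N ((l + h)%:R : R) mu (ext nu).
  have row (r : 'I_N.+1) : 0 <= \prod_(ext nu r <= c < mu r) shift (l%:R : R) r c <=
      \prod_(ext nu r <= c < mu r) plain ((l + h)%:R : R) r c.
    rewrite big_nat_cond [X in _ <= _ <= X]big_nat_cond.
    rewrite prodr_ge0 /= => [|c /andP[/andP[_ /box/andP[]]]//].
    by apply: ler_prod => c /andP[/andP[_ /box]].
  rewrite prodr_ge0 /= => [|r _]; last by case/andP: (row r).
  by apply: ler_prod => r _; apply: row.
have /andP[wt1 wt2] := wt.
by rewrite !mul1r mulr_ge0 //= ler_pM.
Qed.
End Vanishing.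

(** * Lattice paths and tableaux *)

(* The number of saturated chains of length m from a to b in Young's lattice. *)
Fixpoint paths (N m : nat) (a b : nat -> nat) : nat :=
  if m is m'.+1 then (\sum_(i < N) noninc N (incr i a) * paths N m' (incr i a) b)%N
  else [forall i : 'I_N, a i == b i].

Lemma paths_eq0 N m a b i : (i < N)%N -> (b i < a i)%N -> paths N m a b = 0%N.
Proof.
move=> lt_iN; elim: m a => [|m IH] a lt_ba /=.
  by rewrite (_ : [forall i, _] = false) //; apply/forallP => /(_ (Ordinal lt_iN)) /eqP /=; lia.
by rewrite big1 // => j _; rewrite IH ?muln0 //; rewrite /incr; lia.
Qed.

Lemma eq_noninc N a b : (forall i, (i < N)%N -> a i = b i) -> noninc N a = noninc N b.
Proof.
by move=> eq_ab; apply/nonincP/nonincP => H i lt_i; have := H i lt_i; rewrite !eq_ab // ltnW.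
Qed.

(** [paths] unfolds at its lower end, as the Pieri rule requires; the box-removal inequality needs
    the recursion at the upper end. *)
Lemma paths_last N m a b : noninc N a -> noninc N b ->
  paths N m.+1 a b =
  (\sum_(r < N) (0 < b r) * noninc N (decr r b) * paths N m a (decr r b))%N.
Proof.
elim: m a => [|m IH] a a_ni b_ni.
  apply: eq_bigr => r _ /=; rewrite !mulnb; congr nat_of_bool.
  apply/andP/andP => [[_ /forallP/= eq_ab]|[/andP[b_gt0 _] /forallP/= eq_ab]].
    have b_gt0 : (0 < b r)%N by have /eqP := eq_ab r; rewrite incr_eq; lia.
    have eq_a i : (i < N)%N -> a i = decr r b i.
      move=> lt_i; have /eqP /= := eq_ab (Ordinal lt_i); rewrite /incr /decr; lia.
    rewrite b_gt0 -(eq_noninc eq_a) a_ni; split=> //; apply/forallP => i.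
    by rewrite eq_a.
  have eq_a i : (i < N)%N -> incr r a i = b i.
    move=> lt_i; have /eqP /= := eq_ab (Ordinal lt_i); rewrite /incr /decr.
    by case: (eqVneq i r) => [->|]; lia.
  by rewrite (eq_noninc eq_a) b_ni; split=> //; apply/forallP => i; rewrite eq_a.
transitivity (\sum_(i < N) \sum_(r < N) noninc N (incr i a) *
     ((0 < b r) * noninc N (decr r b) * paths N m (incr i a) (decr r b)))%N.
  apply: eq_bigr => i _; rewrite -big_distrr /=.
  by have [i_ni|_] := boolP (noninc N (incr i a)); rewrite ?mul0n // !mul1n; apply: IH.
rewrite exchange_big; apply: eq_bigr => r _; rewrite /= big_distrr /=.
by apply: eq_bigr => i _; rewrite mulnCA.
Qed.

Section PathsSchur.
Variable R : realDomainType.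
Implicit Types (x M : R) (xs : seq R) (mu nu rho : nat -> nat).

Lemma sum_decr N (mu : nat -> nat) (r : 'I_N) : (0 < mu r)%N ->
  (\sum_(i < N) decr r mu i).+1 = (\sum_(i < N) mu i)%N.
Proof.
move=> mu_gt0; rewrite (bigD1 r) //= [in RHS](bigD1 r) //= decr_eq.
under eq_bigr => i ne_ir do rewrite decr_neq //.
lia.
Qed.

Lemma sum_incr_nat N (mu : nat -> nat) (r : 'I_N) :
  (\sum_(i < N) incr r mu i = (\sum_(i < N) mu i).+1)%N.
Proof. by rewrite -(@sum_decr _ (incr r mu) r) ?incrK // incr_eq. Qed.

(** Iterates [schur_euler]. Weakening the column mu_r - 1 to c makes the factor the same for every
    box, so m steps give a power times a number of chains. *)
Theorem schur_plain_paths K c M xs m mu : (forall x, x \in xs -> 0 <= x <= M) ->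
  noninc (size xs) mu -> (c <= K)%N -> (forall r, (r < size xs)%N -> (mu r <= c)%N) ->
  (\sum_(r < size xs) mu r)%N = m ->
  m`!%:R * schur plain K xs mu <=
  (\sum_(x <- xs) x + M * c%:R) ^+ m * (paths (size xs) m (fun=> 0%N) mu)%:R.
Proof.
move=> xs_M mu_ni le_cK; set N := size xs; set Y := _ + _.
have S_ge0 nu : 0 <= schur plain K xs nu by apply: schur_plain_ge0 => y /xs_M /andP[].
have X_ge0 : 0 <= \sum_(x <- xs) x by rewrite big_seq; apply: sumr_ge0 => y /xs_M /andP[].
elim: m mu mu_ni => [|m IH] mu mu_ni le_muc sum_mu.
  have mu0 r : (r < N)%N -> mu r = 0%N.
    move=> lt_r; apply/eqP; rewrite -leqn0 -sum_mu.
    by rewrite (bigD1 (Ordinal lt_r)) //= leq_addr.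
  rewrite schur0 // expr0 !mul1r /= (_ : [forall i, _]) //.
  by apply/forallP => i; rewrite mu0.
have M_ge0 : (0 < N)%N -> 0 <= M.
  rewrite /N; case: xs xs_M {S_ge0 X_ge0 mu_ni le_muc sum_mu IH N Y} => // x xs xs_M _.
  by have /andP[x_ge0] := xs_M x (mem_head _ _); apply: le_trans.
have step := schur_euler xs_M (fun r lt => leq_trans (le_muc r lt) le_cK).
rewrite factS natrM mulrAC -{1}[m.+1]sum_mu natr_sum.
apply: (@le_trans _ _ (m`!%:R * \sum_(r < N) (0 < mu r)%N%:R * Y * schur plain K xs (decr r mu))).
  rewrite mulrC ler_wpM2l // (le_trans step) //; apply: ler_sum => r _.
  rewrite ler_wpM2r // ler_wpM2l // lerD2l ler_wpM2l ?M_ge0 ?(leq_ltn_trans _ (ltn_ord r)) //.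
  by rewrite ler_nat (leq_trans (leq_pred _)) // le_muc.
rewrite paths_last //; last by apply/nonincP.
rewrite natr_sum !mulr_sumr; apply: ler_sum => r _.
have Y_ge0 : 0 <= Y by rewrite addr_ge0 // mulr_ge0 // M_ge0 // (leq_ltn_trans _ (ltn_ord r)).
have [mu_gt0|_] := ltnP 0 (mu r); last by rewrite !(mul0r, mulr0, mul0n).
have [d_ni|/schur_noninc0->] := boolP (noninc N (decr r mu)); last first.
  by rewrite !(mulr0, muln0, mul0n).
rewrite !mul1n mul1r exprS -mulrA mulrCA; rewrite ler_wpM2l //.
apply: IH => // [i lt_i|]; first by rewrite (leq_trans (leq_subr _ _)) // le_muc.
by apply/eqP; rewrite -eqSS sum_decr // sum_mu.
Qed.

(** At the point la the Pieri factor is |la| - |mu| = m; it drops by one per step and builds m!.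
    After m steps the shapes have size |la|, and vanishing leaves only la. *)
Theorem schur_shift_paths K (la : seq nat) mu m : sorted geq la -> (sumn la < K)%N ->
  noninc (size la) mu -> (\sum_(r < size la) mu r + m)%N = sumn la ->
  m`!%:R * schur shift K [seq l%:R : R | l <- la] mu =
  (paths (size la) m mu (nth 0%N la))%:R * schur shift K [seq l%:R : R | l <- la] (nth 0%N la).
Proof.
move=> la_s lt_K; set N := size la; set xs := map _ _.
have size_xs : size xs = N by rewrite size_map.
have sumE : \sum_(x <- xs) x = (sumn la)%:R by rewrite big_map sumnE natr_sum.
elim: m mu => [|m IH] mu mu_ni sum_mu.
  rewrite fact0 mul1r /=; have [/forallP eq_mu|/forallPn[i ne_i]] :=
    boolP [forall i : 'I_N, mu i == nth 0%N la i].
    by rewrite mul1r; apply: eq_schur => r; rewrite size_xs => lt_r; have /eqP := eq_mu (Ordinal lt_r).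
  (* A shape of the size of la but different from it must be longer than la in some row. *)
  rewrite mul0r; have [/existsP[j lt_j]|/existsPn le_mu] :=
    boolP [exists i : 'I_N, (nth 0 la i < mu i)%N].
    exact: schur_shift_vanish (ltn_ord j) lt_j.
  suff : (\sum_(r < N) mu r < \sum_(r < N) nth 0 la r)%N.
    by rewrite -(addn0 (\sum_(r < N) mu r))%N sum_mu sumnE (big_nth 0%N) big_mkord ltnn.
  rewrite (bigD1 i) // [X in (_ < X)%N](bigD1 i) //= -addSn leq_add //.
    by rewrite ltn_neqAle ne_i leqNgt le_mu.
  by apply: leq_sum => j _; rewrite leqNgt le_mu.
have lt_muK r : (r < size xs)%N -> (mu r < K)%N.
  rewrite size_xs => lt_r; apply: leq_ltn_trans lt_K; rewrite -sum_mu.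
  by rewrite (bigD1 (Ordinal lt_r)) //= -addnA leq_addr.
have := @schur_pieri _ K xs mu; rewrite size_xs => /(_ mu_ni).
rewrite -{1}size_xs => /(_ lt_muK); rewrite sumE -sum_mu natrD natr_sum addrAC subrr add0r => pieri.
rewrite factS mulnC natrM -mulrA pieri mulr_sumr /= natr_sum mulr_suml; apply: eq_bigr => r _.
have [i_ni|] := boolP (noninc N (incr r mu)).
  by rewrite mul1n; apply: IH => //; rewrite sum_incr_nat addSn -addnS.
by move=> i_ni; rewrite schur_noninc0 ?mulr0 ?mul0r // size_xs.
Qed.
End PathsSchur.

Lemma noninc_le N a i j : noninc N a -> (i <= j < N)%N -> (a j <= a i)%N.
Proof.
move=> /nonincP a_ni /andP[/subnK <-]; elim: (j - i)%N => // d IH lt_N.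
by rewrite addSn (leq_trans (a_ni _ _)) // IH // ltnW.
Qed.

Lemma nth_le_head (la : seq nat) i : sorted geq la -> (nth 0 la i <= head 0 la)%N.
Proof. by case: la => [|l la] la_s; [rewrite nth_nil | exact: sorted_geq_head]. Qed.

Lemma noninc_nth N (la : seq nat) : sorted geq la -> noninc N (nth 0%N la).
Proof.
move=> la_s; apply/nonincP => i _; elim: la i la_s => [|l la IH] i la_s; first by rewrite !nth_nil.
by case: i => [|i]; [exact: (sorted_geq_head 1) | exact: IH (path_sorted la_s)].
Qed.

(** * Standard skew tableaux counted by lattice paths *)

Section Tableaux.
Variable la : seq nat.
Hypothesis la_s : sorted geq la.
Local Notation C := ('I_(size la) * 'I_(head 0%N la))%type.
Implicit Types (a : nat -> nat) (c d : C).

(** Here the inner shape is a row-length function, so that the induction can add boxes to it; at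
    [nth 0 mu] this is convertible to [in_skew]. *)
Definition skew a i j : bool := (j < nth 0 la i)%N && ~~ (j < a i)%N.

Definition is_syt p a (T : {ffun C -> 'I_p}) : bool :=
  [forall c : C, if skew a c.1 c.2 then (0 < T c)%N else (T c == 0%N :> nat)]
  && [forall c : C, forall d : C,
      (skew a c.1 c.2 && skew a d.1 d.2 && (T c == T d)) ==> (c == d)]
  && [forall c : C, forall d : C,
      (skew a c.1 c.2 && skew a d.1 d.2 &&
       (c.1 == d.1 :> nat) && (c.2 < d.2)%N) ==> (T c < T d)%N]
  && [forall c : C, forall d : C,
      (skew a c.1 c.2 && skew a d.1 d.2 &&
       (c.2 == d.2 :> nat) && (c.1 < d.1)%N) ==> (T c < T d)%N].

Lemma is_sytP p a (T : {ffun C -> 'I_p}) : reflect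
  [/\ forall c, skew a c.1 c.2 = (0 < T c)%N,
      forall c d, skew a c.1 c.2 -> T c = T d :> nat -> c = d,
      forall c d, skew a c.1 c.2 -> skew a d.1 d.2 -> c.1 = d.1 -> (c.2 < d.2)%N -> (T c < T d)%N
    & forall c d, skew a c.1 c.2 -> skew a d.1 d.2 -> c.2 = d.2 -> (c.1 < d.1)%N -> (T c < T d)%N]
  (is_syt a T).
Proof.
apply: (iffP idP) => [/andP[/andP[/andP[]]]|[T0 Tinj Trow Tcol]].
  move=> /forallP T0 /forallP Tinj /forallP Trow /forallP Tcol.
  have skE c : skew a c.1 c.2 = (0 < T c)%N.
    by have := T0 c; case: ifP => // _ /eqP->.
  split=> // c d sk_c.
  - move=> eq_T; have /forallP/(_ d) := Tinj c.
    by rewrite sk_c skE -eq_T -skE sk_c (val_inj eq_T) eqxx => /eqP.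
  - move=> sk_d eq_cd lt_cd; have /forallP/(_ d) := Trow c.
    by rewrite sk_c sk_d eq_cd eqxx lt_cd.
  - move=> sk_d eq_cd lt_cd; have /forallP/(_ d) := Tcol c.
    by rewrite sk_c sk_d eq_cd eqxx lt_cd.
apply/andP; split; first (apply/andP; split; first (apply/andP; split)).
- by apply/forallP => c; rewrite T0; case: posnP => // ->.
- apply/forallP => c; apply/forallP => d; apply/implyP => /andP[/andP[sk_c _] /eqP eq_T].
  by apply/eqP; apply: (Tinj c d sk_c); rewrite eq_T.
- apply/forallP => c; apply/forallP => d; apply/implyP.
  by move=> /andP[/andP[/andP[sk_c sk_d] /eqP/val_inj eq_cd] lt_cd]; apply: Trow.
- apply/forallP => c; apply/forallP => d; apply/implyP.
  by move=> /andP[/andP[/andP[sk_c sk_d] /eqP/val_inj eq_cd] lt_cd]; apply: Tcol.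
Qed.

Lemma sum_ltn n b : (\sum_(j < n) (j < b) = minn b n)%N.
Proof. by elim: n => [|n IH]; rewrite ?big_ord0 ?big_ord_recr /= ?IH; lia. Qed.

Lemma card_skew N a : (size la <= N)%N -> (forall i, (i < N)%N -> (a i <= nth 0 la i)%N) ->
  (#|[set c : C | skew a c.1 c.2]| + \sum_(i < N) a i = sumn la)%N.
Proof.
move=> le_N le_a; have -> : (\sum_(i < N) a i = \sum_(i < size la) a i)%N.
  rewrite (big_ord_widen _ a le_N) [LHS](bigID (fun i : 'I_N => i < size la)%N) /=.
  rewrite [X in (_ + X)%N]big1 ?addn0 // => i; rewrite -leqNgt => le_i.
  by apply/eqP; rewrite -leqn0 -(nth_default 0%N le_i) le_a.
rewrite sumnE (big_nth 0%N) big_mkord -sum1_card.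
rewrite (eq_bigl (fun c : C => skew a c.1 c.2)) => [|c]; last by rewrite inE.
rewrite -(pair_big_dep xpredT (fun (i : 'I_(size la)) (j : 'I_(head 0%N la)) => skew a i j) (fun _ _ => 1%N)) /=.
rewrite -big_split; apply: eq_bigr => i _ /=.
have le_ai := le_a i (leq_trans (ltn_ord i) le_N).
have le_h := nth_le_head i la_s.
suff : (\sum_(j < head 0 la | skew a i j) 1 + \sum_(j < head 0 la) (j < a i) =
        \sum_(j < head 0 la) (j < nth 0 la i))%N.
  by rewrite !sum_ltn (minn_idPl le_h) (minn_idPl (leq_trans le_ai le_h)).
rewrite big_mkcond -big_split; apply: eq_bigr => j _; rewrite /skew /=.
have [lt_ja|] := ltnP j (a i); last by rewrite andbT; case: ltnP.
by rewrite (leq_trans lt_ja le_ai).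
Qed.

(** Pigeonhole: m+1 cells carry distinct nonzero values below m+2, so all these values occur. *)
Lemma syt_has1 N m a (T : {ffun C -> 'I_m.+2}) : (size la <= N)%N ->
  (forall i, (i < N)%N -> (a i <= nth 0 la i)%N) ->
  (\sum_(i < N) a i + m.+1)%N = sumn la -> is_syt a T ->
  exists c, skew a c.1 c.2 /\ T c = 1%N :> nat.
Proof.
move=> le_N le_a sum_a /is_sytP[T0 Tinj _ _].
set D := [set c : C | skew a c.1 c.2].
have cardD : #|D| = m.+1 by have := card_skew le_N le_a; rewrite -/D; lia.
have TD : T @: D = [set~ ord0].
  apply/eqP; rewrite eqEcard cardsC1 card_ord card_in_imset; last first.
    by move=> c d; rewrite inE => sk_c _ eq_T; apply: Tinj; rewrite ?eq_T.
  rewrite cardD leqnn andbT.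
  by apply/fintype.subsetP => _ /imsetP[c + ->]; rewrite !inE -val_eqE -lt0n -T0.
have : inord 1 \in T @: D by rewrite TD !inE -val_eqE /= inordK.
by case/imsetP => c; rewrite inE => sk_c eq1; exists c; rewrite -eq1 inordK.
Qed.

(** A cell of the skew shape to the left of the entry 1, or above it, would need a positive entry
    smaller than 1. *)
Lemma syt1_corner N m a (T : {ffun C -> 'I_m.+2}) c : (size la <= N)%N ->
  noninc N a -> is_syt a T -> T c = 1%N :> nat ->
  c.2 = a c.1 :> nat /\ noninc N (incr c.1 a).
Proof.
move=> le_N a_ni /is_sytP[T0 Tinj Trow Tcol] T1.
have sk_c : skew a c.1 c.2 by rewrite T0 T1.
have /andP[lt_c] := sk_c; rewrite -leqNgt => ge_c.
have eq_c : c.2 = a c.1 :> nat.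
  apply/eqP; rewrite eqn_leq ge_c andbT leqNgt; apply/negP => lt.
  have lt_h : (c.2.-1 < head 0%N la)%N by have := ltn_ord c.2; lia.
  pose d : C := (c.1, Ordinal lt_h).
  have sk_d : skew a d.1 d.2 by rewrite /skew /=; lia.
  have := Trow d c sk_d sk_c erefl; rewrite T1 -[X in (_ < X)%N -> _]/(nat_of_ord c.2) /=.
  by rewrite T0 in sk_d => /(_ ltac:(lia)); lia.
split=> //; apply/nonincP => k lt_k; have le_k := nonincP _ _ a_ni k lt_k.
rewrite /incr; have [eq_k|ne_k] := eqVneq k.+1 (c.1 : nat); last by lia.
rewrite (_ : (k == c.1) = false) ?addn0; last by lia.
rewrite addn1 ltn_neqAle le_k andbT; apply/eqP => eq_a.
have lt_kr : (k < size la)%N by have := ltn_ord c.1; lia.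
pose d : C := (Ordinal lt_kr, c.2).
have sk_d : skew a d.1 d.2.
  rewrite /skew /= -eq_a eq_k -eq_c ltnn andbT (leq_trans lt_c) //.
  by rewrite -eq_k; apply: (nonincP _ _ (noninc_nth k.+2 la_s)).
have := Tcol d c sk_d sk_c erefl; rewrite T1 /= -eq_k ltnSn => /(_ isT).
by rewrite T0 in sk_d; lia.
Qed.

(* Removing the entry 1 and decrementing the others. *)
Lemma card_syt1 N m a i : (size la <= N)%N -> noninc N a -> (i < N)%N ->
  noninc N (incr i a) -> (a i < nth 0 la i)%N ->
  #|[set T : {ffun C -> 'I_m.+2} | is_syt a T &&
      [exists c : C, (c.1 == i :> nat) && (T c == 1%N :> nat)]]|
  = #|[set T : {ffun C -> 'I_m.+1} | is_syt (incr i a) T]|.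
Proof.
move=> le_N a_ni lt_iN ai_ni lt_ai.
have lt_ir : (i < size la)%N.
  by rewrite ltnNge; apply/negP => le_i; rewrite nth_default in lt_ai.
pose c0 : C := (Ordinal lt_ir, Ordinal (leq_trans lt_ai (nth_le_head i la_s))).
have skE (c : C) : skew (incr i a) c.1 c.2 = skew a c.1 c.2 && (c != c0).
  case: c => x y; rewrite /skew /incr /= xpair_eqE -!val_eqE /=.
  by have [->|_] := eqVneq (x : nat) i; rewrite ?addn0 ?andbT //=; lia.
have sk0 : skew a c0.1 c0.2 by rewrite /skew /= lt_ai ltnn.
pose up (T : {ffun C -> 'I_m.+1}) : {ffun C -> 'I_m.+2} :=
  [ffun c : C => inord (if skew a c.1 c.2 then (T c).+1 else 0%N)].
pose dn (T : {ffun C -> 'I_m.+2}) : {ffun C -> 'I_m.+1} := [ffun c : C => inord (T c).-1].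
have upE (T : {ffun C -> 'I_m.+1}) (c : C) : up T c = (if skew a c.1 c.2 then (T c).+1 else 0%N) :> nat.
  by rewrite ffunE inordK //; case: ifP => _ //; rewrite ltnS ltn_ord.
have dnE (T : {ffun C -> 'I_m.+2}) (c : C) : dn T c = (T c).-1 :> nat.
  by rewrite ffunE inordK //; have := ltn_ord (T c); lia.
have up_inj : {in [set T | is_syt (incr i a) T] &, injective up}.
  move=> T1 T2; rewrite !inE => /is_sytP[T10 _ _ _] /is_sytP[T20 _ _ _] eq_up.
  apply/ffunP => c; apply: val_inj => /=; have := upE T1 c; rewrite eq_up upE.
  case: ifP => [_ [] //|nsk _].
  by have := T10 c; have := T20 c; rewrite skE nsk /=; lia.
rewrite -(card_in_imset up_inj); congr #|pred_of_set _|; apply/setP => T; rewrite !inE.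
apply/andP/imsetP => [[/is_sytP[T0 Tinj Trow Tcol] /existsP[c1 /andP[/eqP c1i /eqP Tc1]]]|].
  have [c12 _] := syt1_corner le_N a_ni (introT (is_sytP _ _) (And4 T0 Tinj Trow Tcol)) Tc1.
  have Tc0 : T c0 = 1%N :> nat.
    rewrite -Tc1; congr (nat_of_ord (T _)); case: c1 c1i c12 {Tc1} => x y /= xi yi.
    by apply/eqP; rewrite xpair_eqE -!val_eqE /= xi yi xi !eqxx.
  (* Only [c0] has entry 1, so decrementing keeps all other entries of the skew shape positive. *)
  have T_gt1 (c : C) : skew (incr i a) c.1 c.2 -> (1 < T c)%N.
    rewrite skE => /andP[sk_c ne_c]; rewrite ltn_neqAle -T0 sk_c andbT.
    apply: contraNneq ne_c => Tc; apply/eqP/Tinj => //.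
    by rewrite Tc0 -Tc.
  have sk_incr (c : C) : skew (incr i a) c.1 c.2 -> skew a c.1 c.2 by rewrite skE => /andP[].
  have pred_lt u v : (1 < u -> u < v -> u.-1 < v.-1)%N by lia.
  exists (dn T).
    rewrite inE; apply/is_sytP; split=> [c|c d sk_c|c d sk_c sk_d|c d sk_c sk_d].
    - rewrite dnE; apply/idP/idP => [/T_gt1|]; rewrite -subn1 subn_gt0 // => lt1.
      rewrite skE T0 (ltnW lt1) /=.
      by apply: contraTneq lt1 => ->; rewrite Tc0.
    - rewrite !dnE => eq_T; apply: Tinj; first exact: sk_incr.
      have := T_gt1 c sk_c; move: eq_T.
      by set u := nat_of_ord _; set v := nat_of_ord _; lia.
    - move=> eq_cd lt_cd; rewrite !dnE; apply: pred_lt (T_gt1 c sk_c) _.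
      exact: Trow (sk_incr _ sk_c) (sk_incr _ sk_d) eq_cd lt_cd.
    - move=> eq_cd lt_cd; rewrite !dnE; apply: pred_lt (T_gt1 c sk_c) _.
      exact: Tcol (sk_incr _ sk_c) (sk_incr _ sk_d) eq_cd lt_cd.
  apply/ffunP => c; apply: val_inj; rewrite /= upE dnE T0.
  by case: posnP => [->|/prednK->].
move=> [T']; rewrite inE => /is_sytP[T0 Tinj Trow Tcol] ->.
have T'0 : T' c0 = 0%N :> nat by have := T0 c0; rewrite skE eqxx andbF; case: posnP.
split; last first.
  by apply/existsP; exists c0; rewrite upE sk0 T'0 !eqxx.
apply/is_sytP; split=> [c|c d sk_c|c d sk_c sk_d|c d sk_c sk_d].
- by rewrite upE; case: ifP.
- rewrite !upE sk_c; case: ifP => // sk_d [eq_T].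
  have [eq_c|ne_c] := eqVneq c c0.
    rewrite eq_c; have [->//|ne_d] := eqVneq d c0.
    by have := T0 d; rewrite skE sk_d ne_d -eq_T eq_c T'0.
  by apply: Tinj eq_T; rewrite skE sk_c.
- move=> eq_cd lt_cd; rewrite !upE sk_c sk_d ltnS.
  have ne_d : d != c0.
    apply: contraTneq lt_cd => d0; rewrite -leqNgt d0 /=.
    by move: sk_c; rewrite /skew eq_cd d0 /= -leqNgt => /andP[].
  have sk_d' : skew (incr i a) d.1 d.2 by rewrite skE sk_d ne_d.
  have [->|ne_c] := eqVneq c c0; first by rewrite T'0 -T0.
  by apply: Trow => //; rewrite skE sk_c.
- move=> eq_cd lt_cd; rewrite !upE sk_c sk_d ltnS.
  (* The cells above [c0] in its column lie in the inner shape, because [incr i a] is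
     non-increasing. *)
  have ne_d : d != c0.
    apply: contraTneq lt_cd => d0; rewrite -leqNgt d0 /= leqNgt; apply/negP => lt_ci.
    move: sk_c; rewrite /skew eq_cd d0 /= -leqNgt => /andP[_].
    have : (c.1 <= i < N)%N by rewrite ltnW.
    by move/(noninc_le ai_ni); rewrite incr_eq incr_neq ?ltn_eqF //; lia.
  have sk_d' : skew (incr i a) d.1 d.2 by rewrite skE sk_d ne_d.
  have [->|ne_c] := eqVneq c c0; first by rewrite T'0 -T0.
  by apply: Tcol => //; rewrite skE sk_c.
Qed.

(** Tableaux are sorted by the row of the entry 1, which matches the first step of a path. N may
    exceed the number of rows of la, so that f^mu can be counted with as many rows as the larger
    shape has. *)
Theorem card_syt N m a : (size la <= N)%N -> noninc N a ->
  (forall i, (i < N)%N -> (a i <= nth 0 la i)%N) ->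
  (\sum_(i < N) a i + m)%N = sumn la ->
  #|[set T : {ffun C -> 'I_m.+1} | is_syt a T]| = paths N m a (nth 0%N la).
Proof.
move=> le_N; elim: m a => [|m IH] a a_ni le_a sum_a.
  have card0 : #|[set c : C | skew a c.1 c.2]| = 0%N.
    by have := card_skew le_N le_a; rewrite -sum_a; lia.
  have nsk (c : C) : skew a c.1 c.2 = false.
    by apply/negP => sk_c; move/eqP: card0; rewrite cards_eq0 => /eqP/setP/(_ c); rewrite !inE sk_c.
  rewrite (_ : [set T | _] = [set: {ffun C -> 'I_1}]); last first.
    apply/setP => T; rewrite !inE; apply/is_sytP; split=> [c|c d|c d|c d]; rewrite nsk //.
    by rewrite ord1.
  rewrite cardsT card_ffun card_ord exp1n /= (_ : [forall i, _]) //; apply/forallP => i.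
  rewrite eqn_leq le_a //= leqNgt; apply/negP => lt_i.
  have lt_ir : (i < size la)%N by rewrite ltnNge; apply/negP => le_i; rewrite nth_default in lt_i.
  have := nsk (Ordinal lt_ir, Ordinal (leq_trans lt_i (nth_le_head i la_s))).
  by rewrite /skew /= lt_i ltnn.
pose oneat (T : {ffun C -> 'I_m.+2}) (i : nat) :=
  [exists c : C, (c.1 == i :> nat) && (T c == 1%N :> nat)].
have -> : #|[set T : {ffun C -> 'I_m.+2} | is_syt a T]| =
    (\sum_(i < N) #|[set T : {ffun C -> 'I_m.+2} | is_syt a T && oneat T i]|)%N.
  under eq_bigr => i _ do rewrite -sum1_card big_mkcond /=.
  rewrite exchange_big -sum1_card big_mkcond /=; apply: eq_bigr => T _; rewrite inE.
  have [T_syt|nT_syt] := boolP (is_syt a T); last first.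
    by rewrite big1 // => i _; rewrite inE (negPf nT_syt).
  have [c [sk_c Tc]] := syt_has1 le_N le_a sum_a T_syt.
  rewrite (bigD1 (widen_ord le_N c.1)) //= inE T_syt /=.
  rewrite (_ : oneat T c.1); last by apply/existsP; exists c; rewrite Tc !eqxx.
  rewrite big1 // => i ne_i; rewrite inE T_syt /= (_ : oneat T i = false) //.
  apply: contraNF ne_i => /existsP[d /andP[/eqP d_i /eqP Td]].
  have /is_sytP[_ Tinj _ _] := T_syt.
  by rewrite -val_eqE /= -d_i (Tinj c d) // Tc Td.
apply: eq_bigr => i _.
have [/andP[ai_ni lt_i]|nadd] := boolP (noninc N (incr i a) && (a i < nth 0 la i)%N).
  rewrite ai_ni mul1n (@card_syt1 N) //; apply: IH => //.
    move=> j lt_j; rewrite /incr; have [eq_j|_] := eqVneq j (i : nat); last by rewrite addn0 le_a.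
    by rewrite addn1 eq_j.
  by rewrite sum_incr_nat addSn -addnS.
have -> : (noninc N (incr i a) * paths N m (incr i a) (nth 0 la) = 0)%N.
  move: nadd; have [ai_ni /= |//] := boolP (noninc N (incr i a)); rewrite -leqNgt => ge_i.
  by rewrite (@paths_eq0 _ _ _ _ i) // incr_eq.
apply/eqP; rewrite cards_eq0; apply/eqP/setP => T; rewrite !inE.
apply: contraNF nadd => /andP[T_syt /existsP[c /andP[/eqP c_i /eqP Tc]]].
have [eq_c] := syt1_corner le_N a_ni T_syt Tc; rewrite -c_i => -> /=.
by have /is_sytP[T0 _ _ _] := T_syt; have := T0 c; rewrite Tc /skew -eq_c => /andP[].
Qed.
End Tableaux.

Lemma subpart_nth (la mu : seq nat) i : subpart mu la -> (nth 0 mu i <= nth 0 la i)%N.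
Proof.
move=> /andP[_ /allP le_nth]; have [lt_i|le_i] := ltnP i (size mu); last by rewrite nth_default.
by apply: le_nth; rewrite mem_iota.
Qed.

Lemma sum_nth N (s : seq nat) : (size s <= N)%N -> (\sum_(i < N) nth 0 s i)%N = sumn s.
Proof.
move=> le_N; rewrite sumnE (big_nth 0%N) big_mkord (big_ord_widen _ (nth 0%N s) le_N).
rewrite [LHS](bigID (fun i : 'I_N => i < size s)%N) /=.
by rewrite [X in (_ + X)%N]big1 ?addn0 // => i; rewrite -leqNgt => /(nth_default 0%N).
Qed.

Theorem f_skew_paths N (la mu : seq nat) : is_partition la -> is_partition mu ->
  subpart mu la -> (size la <= N)%N ->
  f_skew la mu = paths N (sumn la - sumn mu) (nth 0%N mu) (nth 0%N la).
Proof.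
move=> /andP[la_s _] /andP[mu_s _] sub le_N; rewrite /f_skew sub.
have le_mu i := subpart_nth i sub; have /andP[le_size _] := sub.
apply: card_syt => //; first exact: noninc_nth.
rewrite sum_nth ?(leq_trans le_size) // subnKC // -(sum_nth le_N) -(sum_nth (leq_trans le_size le_N)).
exact: leq_sum.
Qed.

Lemma f_shape_paths N (nu : seq nat) : is_partition nu -> (size nu <= N)%N ->
  f_shape nu = paths N (sumn nu) (fun=> 0%N) (nth 0%N nu).
Proof.
move=> nu_p le_N; rewrite /f_shape (f_skew_paths nu_p _ _ le_N) // subn0.
by congr paths; apply: funext => i; rewrite nth_nil.
Qed.

(** * The bound on A and its asymptotic form *)

Lemma A_skew_le (R : realType) (la mu : seq nat) : is_partition la -> is_partition mu ->
  (sumn mu < sumn la)%N ->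
  A_skew R la mu <=
  (((sumn la)%:R + (size la)%:R * (size mu)%:R +
     ((head 0%N la)%:R + (size mu)%:R) * (head 0%N mu)%:R) / (sumn la - sumn mu)%:R) ^+ (sumn mu).
Proof.
move=> la_p mu_p lt_sum; rewrite /A_skew; set n := sumn la; set k := sumn mu.
set N := size la; set h := size mu; set c := head 0%N mu; set Y := _ + _ * c%:R.
have Y_ge0 : 0 <= Y by rewrite addr_ge0 ?mulr_ge0 // addr_ge0 ?mulr_ge0.
have [sub|nsub] := boolP (subpart mu la); last first.
  by rewrite /f_skew (negPf nsub) mulr0 mul0r exprn_ge0 // divr_ge0.
have [la_s _] := andP la_p; have [mu_s _] := andP mu_p.
have /andP[le_hN _] := sub; have le_mu i := subpart_nth i sub.
pose K := (n + c).+1; pose S := schur shift K [seq l%:R : R | l <- la].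
have lt_nK : (n < K)%N by rewrite ltnS leq_addr.
(* Starting from the empty shape, where s* is 1, gives n!; the factor [S (nth 0 la)] cancels against
   the one in [eq_nk]. *)
have eq_n : n`!%:R = (f_shape la)%:R * S (nth 0%N la).
  rewrite (f_shape_paths la_p (leqnn N)) -(schur_shift_paths _ la_s lt_nK).
  - by rewrite schur0 // mulr1.
  - by apply/nonincP.
  - by rewrite big1.
have eq_nk : (n - k)`!%:R * S (nth 0%N mu) = (f_skew la mu)%:R * S (nth 0%N la).
  rewrite (f_skew_paths la_p mu_p sub (leqnn N)) (schur_shift_paths _ la_s lt_nK) //.
  - exact: noninc_nth.
  - by rewrite sum_nth // subnKC // ltnW.
have /andP[S_ge0 le_S] : 0 <= S (nth 0%N mu) <=
    schur plain K [seq (l + h)%:R : R | l <- la] (nth 0%N mu).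
  by apply: schur_shift_le => // r _ le_hr; rewrite nth_default.
have eq_k : k`!%:R * schur plain K [seq (l + h)%:R : R | l <- la] (nth 0%N mu) <=
    Y ^+ k * (f_shape mu)%:R.
  have := @schur_plain_paths R K c ((head 0%N la)%:R + h%:R) [seq (l + h)%:R : R | l <- la] k (nth 0%N mu).
  rewrite size_map (f_shape_paths mu_p le_hN).
  have -> : \sum_(x <- [seq (l + h)%:R : R | l <- la]) x = n%:R + N%:R * h%:R.
    rewrite big_map; under eq_bigr => l _ do rewrite natrD.
    by rewrite big_split /= -natr_sum -sumnE big_const_seq count_predT iter_addr addr0 mulr_natl.
  apply.
  - move=> x /mapP[l la_l ->]; rewrite ler0n -natrD ler_nat leq_add2r.
    by rewrite -(nth_index 0%N la_l) nth_le_head.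
  - exact: noninc_nth.
  - by rewrite /K; lia.
  - by move=> r _; apply: nth_le_head.
  - by rewrite sum_nth.
have S_neq0 : S (nth 0%N la) != 0.
  by apply: contra_eq_neq eq_n => ->; rewrite mulr0 pnatr_eq0 -lt0n fact_gt0.
have fla_gt0 : 0 < (f_shape la)%:R :> R.
  rewrite lt0r ler0n andbT; apply: contra_eq_neq eq_n => ->.
  by rewrite mul0r pnatr_eq0 -lt0n fact_gt0.
(* If f^mu were 0, the convention for inverting 0 would make the left side 0; this replaces a proof
   that mu has a tableau. *)
have [->|fmu_neq0] := eqVneq (f_shape mu) 0%N.
  by rewrite mulr0 invr0 mulr0 exprn_ge0 // divr_ge0.
have fmu_gt0 : 0 < (f_shape mu)%:R :> R by rewrite ltr0n lt0n.
have AE : (k`!)%:R * (f_skew la mu)%:R / ((f_shape la)%:R * (f_shape mu)%:R) =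
    (n - k)`!%:R / n`!%:R * (k`!%:R * S (nth 0%N mu) / (f_shape mu)%:R) :> R.
  have -> : (f_skew la mu)%:R = (n - k)`!%:R * S (nth 0%N mu) / S (nth 0%N la).
    by rewrite eq_nk mulfK.
  by rewrite eq_n; field; rewrite S_neq0 !gt_eqF.
have le_ff : (n - k)`!%:R / n`!%:R <= ((n - k)%:R ^+ k)^-1 :> R.
  rewrite -(@ffact_fact n k) 1?ltnW // natrM invfM mulrCA divff ?mulr1; last first.
    by rewrite pnatr_eq0 -lt0n fact_gt0.
  have nk_gt0 : (0 < n - k)%N by rewrite subn_gt0.
  have ff_gt0 : (0 < n ^_ k)%N by rewrite ffact_gt0 ltnW.
  rewrite lef_pV2 ?posrE ?exprn_gt0 ?ltr0n // -natrX ler_nat.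
  suff le_ff j : (j <= k)%N -> ((n - k) ^ j <= n ^_ j)%N by exact: le_ff.
  elim: j => // j IH lt_jk; rewrite expnSr ffactnSr leq_mul //; last by rewrite leq_sub2l // ltnW.
  by rewrite IH // ltnW.
rewrite AE expr_div_n mulrC ler_pM //.
- by rewrite divr_ge0 // mulr_ge0.
- by rewrite divr_ge0.
- rewrite ler_pdivrMr // (le_trans _ eq_k) // ler_wpM2l //.
Qed.

(** Each of N h, l c and h c is at most L^2 sqrt (n k), and 2 k < n makes n - k more than n / 2,
    which doubles the constant. *)
Lemma growth_le (R : realType) (L n k N h l c : R) : 0 < L ->
  0 <= N -> 0 <= h -> 0 <= l -> 0 <= c -> 0 <= k -> 2 * k < n ->
  N <= L * Num.sqrt n -> l <= L * Num.sqrt n -> h <= L * Num.sqrt k -> c <= L * Num.sqrt k ->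
  (n + N * h + (l + h) * c) / (n - k) <=
  expR ((6 * L ^+ 2 + 2) * Num.sqrt k / Num.sqrt n).
Proof.
move=> L_gt0 N_ge0 h_ge0 l_ge0 c_ge0 k_ge0 lt_kn le_N le_l le_h le_c.
have n_gt0 : 0 < n by lra.
set u := Num.sqrt n; set v := Num.sqrt k.
have u_gt0 : 0 < u by rewrite sqrtr_gt0.
have v_ge0 : 0 <= v by rewrite sqrtr_ge0.
have nE : n = u ^+ 2 by rewrite sqr_sqrtr // ltW.
have kE : k = v ^+ 2 by rewrite sqr_sqrtr.
have le_vu : v <= u by rewrite ler_wsqrtr //; lra.
apply: le_trans (expR_ge1Dx _).
rewrite ler_pdivrMr; last by lra.
have h1 : N * h <= (L * u) * (L * v) by apply: ler_pM.
have h2 : (l + h) * c <= (L * u + L * u) * (L * v).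
  apply: ler_pM => //; first exact: addr_ge0.
  by rewrite lerD // (le_trans le_h) // ler_pM2l.
set q := v / u; have vE : v = q * u by rewrite divfK ?gt_eqF.
have q_ge0 : 0 <= q by rewrite divr_ge0 // ltW.
rewrite -mulrA -/q.
have q2 : 2 * q ^+ 2 < 1.
  have : 2 * (q ^+ 2 * u ^+ 2) < 1 * u ^+ 2 by rewrite -exprMn -vE -kE -nE mul1r.
  by rewrite mulrA ltr_pM2r // exprn_gt0.
have q1 : q <= 1 by nra.
(* After division by u^2 the claim is 1 + 3 L^2 q <= (1 + (6 L^2 + 2) q) (1 - q^2). The difference
   of the two sides is split here into two nonnegative terms. *)
have key : 0 <= u ^+ 2 * (q * (1 - q) + (3 * L ^+ 2 + 1) * q * (1 - 2 * q ^+ 2)).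
  have B_ge0 : 0 <= 3 * L ^+ 2 + 1 by have := exprn_ge0 2 (ltW L_gt0); lra.
  apply: mulr_ge0; first by rewrite exprn_ge0 // ltW.
  have q1' : 0 <= 1 - q by lra.
  have q2' : 0 <= 1 - 2 * q ^+ 2 by lra.
  exact: addr_ge0 (mulr_ge0 q_ge0 q1') (mulr_ge0 (mulr_ge0 B_ge0 q_ge0) q2').
apply: (@le_trans _ _ (n + (L * u) * (L * v) + (L * u + L * u) * (L * v))).
  by rewrite lerD // lerD2l.
rewrite -subr_ge0 (le_trans key) // kE nE vE le_eqVlt; apply/orP; left; apply/eqP; ring.
Qed.

Theorem theorem1p4 (R : realType) (L : R) (hL : 0 < L) :
  exists C1 C2 : R, 0 < C1 /\ 0 < C2 /\
  forall (n k : nat) (la mu : seq nat),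
    partition_of la n -> partition_of mu k ->
    (size la)%:R < L * Num.sqrt (n%:R) ->
    (head 0%N la)%:R < L * Num.sqrt (n%:R) ->
    (size mu)%:R < L * Num.sqrt (k%:R) ->
    (head 0%N mu)%:R < L * Num.sqrt (k%:R) ->
    k%:R < C1 * Num.sqrt (n%:R) ->
    A_skew R la mu <= expR (C2 * (k%:R * Num.sqrt (k%:R)) / Num.sqrt (n%:R)).
Proof.
have L2_ge0 : 0 <= L ^+ 2 by rewrite exprn_ge0 // ltW.
(* The choice 1 / 2 gives 2 k < sqrt n <= n, as [growth_le] requires; the second constant is the one
   in its exponent. *)
exists (1 / 2), (6 * L ^+ 2 + 2); split; first by lra.
split; first by lra.
move=> n k la mu /andP[la_p /eqP <-] /andP[mu_p /eqP <-].
set n' := sumn la; set k' := sumn mu => size_la head_la size_mu head_mu lt_k.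
have n_gt0 : (0 < n')%N.
  by rewrite lt0n; apply: contraTneq lt_k => ->; rewrite sqrtr0 mulr0 -leNgt.
have sqrt_le : Num.sqrt n'%:R <= n'%:R :> R.
  have n_ge1 : 1 <= n'%:R :> R by rewrite ler1n.
  rewrite -[leRHS]ger0_norm // -sqrtr_sqr ler_wsqrtr // expr2 ler_peMl //.
have lt_2k : 2 * k'%:R < n'%:R :> R by lra.
have lt_kn : (k' < n')%N by rewrite -(ltr_nat R); have := ler0n R k'; lra.
apply: le_trans (A_skew_le R la_p mu_p lt_kn) _.
have := growth_le hL (ler0n _ _) (ler0n _ _) (ler0n _ _) (ler0n _ _) (ler0n _ _) lt_2k
  (ltW size_la) (ltW head_la) (ltW size_mu) (ltW head_mu).
rewrite -natrB ?(ltnW lt_kn) // => le_growth.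
rewrite (_ : _ * _ / _ = k'%:R * ((6 * L ^+ 2 + 2) * Num.sqrt k'%:R / Num.sqrt n'%:R)); last by ring.
rewrite expRM_natl; apply: lerXn2r => //; rewrite nnegrE ?expR_ge0 //.
by rewrite divr_ge0 // addr_ge0 ?mulr_ge0 // addr_ge0 // mulr_ge0.
Qed.
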